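(* Let $X$ be a non-empty set, $\mathcal{I}$ a D-index set with zero $0_{\mathcal{I}}$, and $\mathbf{d}$ a pseudo uniform $\mathcal{I}$-metric on $X$. Then $\mathcal{B}_{\mathbf{d}}=\{\mathbf{D}_\alpha:\alpha\in\mathcal{I}\setminus\{0_{\mathcal{I}}\}\}$ is a base for a uniform structure $\mathcal{U}_{\mathbf{d}}$ on $X$. If, in addition, $\mathbf{d}$ is a uniform $\mathcal{I}$-metric, then the topology induced by $\mathcal{U}_{\mathbf{d}}$ is Hausdorff.
   Context: $\mathcal{P}_0(X\times X)$ is the collection of non-empty subsets of $X\times X$; $\Delta_X=\{(x,x):x\in X\}$; for $A,B\subseteq X\times X$, $A^{-1}=\{(y,x):(x,y)\in A\}$ and $A\circ B=\{(x,z):\exists y\in X,\ (x,y)\in A,\ (y,z)\in B\}$. A uniform structure on $X$ is a (non-empty) collection $\mathcal{U}\subseteq\mathcal{P}_0(X\times X)$ such that for all $U,V\in\mathcal{U}$ and $S\in\mathcal{P}_0(X\times X)$ with $U\subseteq S$ one has $\Delta_X\subseteq U$, $U\cap V,\,U^{-1},\,S\in\mathcal{U}$, and there is $W\in\mathcal{U}$ with $W\circ W\subseteq U$. A subcollection $\mathcal{B}\subseteq\mathcal{U}$ is a base for $\mathcal{U}$ if every $U\in\mathcal{U}$ contains some $V\in\mathcal{B}$. A D-index set is a partially ordered set $\mathcal{I}$ with a smallest element (zero) $0_{\mathcal{I}}$ such that $\mathcal{I}\setminus\{0_{\mathcal{I}}\}$ is non-empty and downward directed (any two elements have a common lower bound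 in it). $\mathcal{I}_\infty$ is $\mathcal{I}$ with a new element $\infty$ adjoined that is strictly larger than all elements of $\mathcal{I}$. For $\mathbf{d}:X\times X\to\mathcal{I}_\infty$ and $\alpha\in\mathcal{I}$, $\mathbf{D}_\alpha=\{(x,y)\in X\times X:\mathbf{d}(x,y)\le\alpha\}$. $\mathbf{d}$ is a pseudo uniform $\mathcal{I}$-metric if $\mathbf{d}(x,x)=0_{\mathcal{I}}$ and $\mathbf{d}(x,y)=\mathbf{d}(y,x)$ for all $x,y$, and there is $\Psi:\mathcal{I}\setminus\{0_{\mathcal{I}}\}\to\mathcal{I}\setminus\{0_{\mathcal{I}}\}$ with $\mathbf{D}_{\Psi(\beta)}\circ\mathbf{D}_{\Psi(\beta)}\subseteq\mathbf{D}_\beta$ for all $\beta\in\mathcal{I}\setminus\{0_{\mathcal{I}}\}$. It is a uniform $\mathcal{I}$-metric if moreover $\bigcap_{\alpha\in\mathcal{I}\setminus\{0_{\mathcal{I}}\}}\mathbf{D}_\alpha=\Delta_X$. *)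

(* Defs.v *)
From HB Require Import structures.
From mathcomp Require Import all_boot all_order.
From mathcomp Require Import all_classical.
From mathcomp Require Import topology.

Set Implicit Arguments.
Unset Strict Implicit.
Unset Printing Implicit Defensive.

Import Order.TTheory.

Local Open Scope order_scope.
Local Open Scope classical_set_scope.
Local Open Scope relation_scope.

(* The members of U range over the non-empty subsets of X * X. In the library,
   A \; B is the set of the (x, z) such that A (x, y) and B (y, z) for some y,
   and A^-1 is the set of the (y, x) such that A (x, y). *)
Record uniform_structure (X : Type) (U : set_system (X * X)) : Prop := {
  us_neq0 : U !=set0;
  us_mem_neq0 : U `<=` [set A | A !=set0];
  us_diagonal : forall A, U A -> diagonal `<=` A;
  us_setI : forall A B, U A -> U B -> U (A `&` B);
  us_inv : forall A, U A -> U A^-1;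
  us_super : forall A S, U A -> S !=set0 -> A `<=` S -> U S;
  us_split : forall A, U A -> exists2 W, U W & W \; W `<=` A }.

Definition is_base (X : Type) (B U : set_system (X * X)) : Prop :=
  B `<=` U /\ forall A, U A -> exists2 V, B V & V `<=` A.

(* A copy of X, carrying the uniformity U and the topology induced by U: the
   neighborhoods of x are the supersets of the sections [set y | A (x, y)],
   for A in U. *)
Definition uspace (X : Type) (U : set_system (X * X))
  (hU : uniform_structure U) : Type := X.

Section uspace_instances.
Context (X : Type) (U : set_system (X * X)) (hU : uniform_structure U).

Lemma uniform_structure_filter : Filter U.
Proof.
have UT : U setT.
  have [A UA] := us_neq0 hU; have [p Ap] := us_mem_neq0 hU UA.
  by apply: (us_super hU UA) => //; exists p.
split=> //; first exact: us_setI hU.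
move=> P Q PQ UP; apply: (us_super hU UP) => //.
by have [p Pp] := us_mem_neq0 hU UP; exists p; exact: PQ.
Qed.

HB.instance Definition _ := gen_eqMixin (uspace hU).
HB.instance Definition _ := gen_choiceMixin (uspace hU).
HB.instance Definition _ := @isUniform.Build (uspace hU) U
  uniform_structure_filter (us_diagonal hU) (us_inv hU) (us_split hU).

Lemma entourage_uspaceE : @entourage (uspace hU) = U.
Proof. by []. Qed.

Lemma nbhs_uspaceE (x : uspace hU) :
  nbhs x = [set N | exists2 A, U A & [set y | A (x, y)] `<=` N].
Proof.
apply/seteqP; split=> N [A UA AN]; exists A => //.
- by move=> y Axy; apply: AN; apply/xsectionP.
- by move=> y /xsectionP Axy; exact: AN.
Qed.

End uspace_instances.

(* \bot is the zero of the index set. *)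
Definition D_index d (I : bPOrderType d) : Prop :=
  [set~ \bot : I] !=set0 /\
  forall a b : I, a != \bot -> b != \bot ->
    exists c : I, [/\ c != \bot, c <= a & c <= b].

(* I with a new element adjoined on top, denoted \top below. *)
Definition adjoin_infty (I : Type) : Type := option I.

Definition of_index (I : Type) (a : I) : adjoin_infty I := Some a.

Section adjoin_infty_order.
Context d (I : porderType d).

HB.instance Definition _ := Choice.on (adjoin_infty I).

Definition infty_le (u v : adjoin_infty I) : bool :=
  match u, v with
  | Some a, Some b => a <= b
  | _, None => true
  | None, Some _ => false
  end.

Lemma infty_le_refl : reflexive infty_le.
Proof. by case=> //= a. Qed.

Lemma infty_le_anti : antisymmetric infty_le.
Proof. by move=> [a|] [b|] //= /le_anti ->. Qed.

Lemma infty_le_trans : transitive infty_le.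
Proof. by move=> [b|] [a|] [c|] //=; exact: le_trans. Qed.

HB.instance Definition _ := Order.Le_isPOrder.Build d (adjoin_infty I)
  infty_le_refl infty_le_anti infty_le_trans.

Lemma infty_lex1 (u : adjoin_infty I) : u <= None.
Proof. by case: u. Qed.

HB.instance Definition _ := Order.hasTop.Build d (adjoin_infty I) infty_lex1.

Lemma of_index_le (a b : I) : (of_index a <= of_index b) = (a <= b).
Proof. by []. Qed.

Lemma of_index_lt_infty (a : I) : of_index a < \top.
Proof. by []. Qed.

End adjoin_infty_order.

Section uniform_metric.
Context (X : Type) d (I : bPOrderType d) (dist : X * X -> adjoin_infty I).

Definition Dset (a : I) : set (X * X) := [set p | dist p <= of_index a].

Definition Dsets : set_system (X * X) := [set Dset a | a in [set~ \bot]].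

Definition pseudo_uniform_metric : Prop :=
  [/\ forall x, dist (x, x) = of_index \bot,
      forall x y, dist (x, y) = dist (y, x) &
      exists Psi : {a : I | a != \bot} -> {a : I | a != \bot},
        forall b, Dset (val (Psi b)) \; Dset (val (Psi b)) `<=` Dset (val b)].

Definition uniform_metric : Prop :=
  pseudo_uniform_metric /\ \bigcap_(a in [set~ \bot]) Dset a = diagonal.

End uniform_metric.

(* Main.v *)
Require Import Defs.
From mathcomp Require Import all_boot all_order.
From mathcomp Require Import all_classical.
From mathcomp Require Import topology.

(** The uniform structure is the family of all supersets of the sets
    [Dset dist a] with [a != \bot]. Every axiom is inherited from a property of
    these sets: they contain the diagonal because [dist (x, x)] is the zero of
    the index set, they are symmetric because [dist] is, the map Psi gives for
    each of them another one whose square lies in it, and they shrink with [a],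
    so that a common lower bound of [a] and [b] gives a set contained in both
    [Dset dist a] and [Dset dist b].

    For the Hausdorff property, let q be a cluster point of the neighborhoods
    of p. Given a nonzero [b], take [a] with
    [Dset dist a \; Dset dist a `<=` Dset dist b] ([Dset_split]). The sections
    of [Dset dist a] at p and at q have a common point z, and going from p to z
    to q shows that (p, q) belongs to [Dset dist b]. As [b] is arbitrary, (p, q)
    lies in the intersection of all these sets, which is the diagonal. *)

Set Implicit Arguments.
Unset Strict Implicit.
Unset Printing Implicit Defensive.

Import Order.TTheory.

Local Open Scope order_scope.
Local Open Scope classical_set_scope.
Local Open Scope relation_scope.

Section generated_uniformity.
Context (X : Type) disp (I : bPOrderType disp) (dist : X * X -> adjoin_infty I).

Definition Dset_supersets : set_system (X * X) :=
  [set A | exists2 a : I, a != \bot & Dset dist a `<=` A].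

Lemma Dset_le (a b : I) : a <= b -> Dset dist a `<=` Dset dist b.
Proof. by move=> ab p /le_trans; apply; rewrite of_index_le. Qed.

Lemma Dset_supersetsP (a : I) : a != \bot -> Dset_supersets (Dset dist a).
Proof. by move=> a0; exists a. Qed.

Lemma Dsets_base : is_base (Dsets dist) Dset_supersets.
Proof.
split=> [_ [a /eqP a0 <-]|A [a /eqP a0 aA]]; first exact: Dset_supersetsP.
by exists (Dset dist a) => //; exists a.
Qed.

Context (dist_pum : pseudo_uniform_metric dist).

Lemma diagonal_Dset (a : I) : diagonal `<=` Dset dist a.
Proof.
have [dist0 _ _] := dist_pum.
by move=> [x y]; rewrite /diagonal /Dset /= => ->; rewrite dist0 of_index_le le0x.
Qed.

Lemma Dset_sym (a : I) (x y : X) : Dset dist a (x, y) -> Dset dist a (y, x).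
Proof. by have [_ distC _] := dist_pum; rewrite /Dset /= distC. Qed.

Lemma Dset_split (b : I) : b != \bot ->
  exists2 a : I, a != \bot & Dset dist a \; Dset dist a `<=` Dset dist b.
Proof.
have [_ _ [Psi PsiP]] := dist_pum.
move=> b0; have := PsiP (exist _ b b0).
by case: (Psi _) => a a0 /= aab; exists a.
Qed.

(** Non-emptiness of [X] is what makes the members of the family non-empty:
    they contain the diagonal. *)
Lemma Dset_supersets_uniform : [set: X] !=set0 -> D_index I ->
  uniform_structure Dset_supersets.
Proof.
move=> [x0 _] [[i /eqP i0] Idir]; split.
- by exists (Dset dist i); exact: Dset_supersetsP.
- by move=> A [a _ aA]; exists (x0, x0); exact/aA/diagonal_Dset.
- by move=> A [a _ aA]; exact: subset_trans (@diagonal_Dset a) aA.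
- move=> A B [a a0 aA] [b b0 bB].
  have [c [c0 ca cb]] := Idir a b a0 b0.
  by exists c => // p cp; split; [exact/aA/(Dset_le ca)|exact/bB/(Dset_le cb)].
- by move=> A [a a0 aA]; exists a => // -[x y] /Dset_sym /aA.
- by move=> A S [a a0 aA] _ AS; exists a => //; exact: subset_trans aA AS.
- move=> A [b b0 bA]; have [a a0 aab] := Dset_split b0.
  by exists (Dset dist a); [exact: Dset_supersetsP|exact: subset_trans aab bA].
Qed.

Lemma Dset_supersets_hausdorff (hU : uniform_structure Dset_supersets) :
  \bigcap_(a in [set~ \bot]) Dset dist a `<=` diagonal ->
  hausdorff_space (uspace hU).
Proof.
move=> capD p q pq.
suff : diagonal ((p, q) : X * X) by [].
apply: capD => b /eqP b0.
have [a a0 aab] := Dset_split b0.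
have nbhsD (x : uspace hU) : nbhs x [set y | Dset dist a (x, y)].
  by rewrite nbhs_uspaceE; exists (Dset dist a) => //; exact: Dset_supersetsP.
have [z [paz qaz]] := pq _ _ (nbhsD p) (nbhsD q).
by apply: aab; exists z => //; exact: Dset_sym.
Qed.

End generated_uniformity.

Theorem proposition15 (X : Type) (disp : Order.disp_t) (I : bPOrderType disp)
  (dist : X * X -> adjoin_infty I) (X_neq0 : [set: X] !=set0)
  (I_index : D_index I) (dist_pum : pseudo_uniform_metric dist) :
  exists (U : set_system (X * X)) (hU : uniform_structure U),
    is_base (Dsets dist) U /\
    (uniform_metric dist -> hausdorff_space (uspace hU)).
Proof.
exists (Dset_supersets dist), (Dset_supersets_uniform dist_pum X_neq0 I_index).
split; first exact: Dsets_base.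
move=> [_ capD]; apply: Dset_supersets_hausdorff => //.
by rewrite capD.
Qed.
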